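(* Let $C_{\mathbf m}$ denote the hyper-Catalan numbers (defined in the context). Then $C_{[\,]}=1$, and for every type $\mathbf m\neq[\,]$, $$C_{\mathbf m}=\sum_{j\ge 2}\ \sum_{\substack{\sum_{\mathbf n\ge 0}k_{\mathbf n}=j\\ \sum_{\mathbf n\ge 0}k_{\mathbf n}\mathbf n=\mathbf m-\vec{j}}}\binom{j}{\mathbf k}\prod_{\mathbf n\ge 0}C_{\mathbf n}^{k_{\mathbf n}},$$ where the inner sum runs over all families $\mathbf k=(k_{\mathbf n})_{\mathbf n}$ of natural numbers indexed by types $\mathbf n$, with only finitely many $k_{\mathbf n}$ nonzero, satisfying the two displayed constraints, and $\binom{j}{\mathbf k}=j!/\prod_{\mathbf n}k_{\mathbf n}!$ is the multinomial coefficient.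
   Context: A type is a vector $\mathbf m=[m_2,m_3,m_4,\ldots]$ of natural numbers (indices start at $2$) with only finitely many nonzero entries; trailing zeros are ignored and $[\,]$ is the zero vector. For $j\ge2$, $\vec{j}$ denotes the type with $1$ in position $j$ and $0$ elsewhere. Vectors are added/subtracted componentwise and scaled by natural numbers. The hyper-Catalan number $C_{\mathbf m}$ is the number of ways to subdivide a polygon with a distinguished side (the roof) by non-crossing diagonals into $m_2$ triangles, $m_3$ quadrilaterals, $m_4$ pentagons, etc.; equivalently $C_{\mathbf m}=\frac{(2m_2+3m_3+4m_4+\cdots)!}{(1+m_2+2m_3+3m_4+\cdots)!\,m_2!\,m_3!\,m_4!\cdots}$. When $\mathbf m-\vec j$ has a negative entry the inner sum is empty. *)

(* Defs.v *)
From mathcomp Require Import all_boot finmap.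
From mathcomp Require Import boolp classical_sets fsbigop.

Set Implicit Arguments.
Unset Strict Implicit.
Unset Printing Implicit Defensive.

(* Positions are shifted by two: for m : ptype, [m i] is the entry m_{i+2},
   the prescribed number of (i+3)-gons. *)
Definition ptype := {fsfun nat -> nat with 0}.

Definition ptype0 : ptype := [fsfun].

(* The type \vec{j}; meaningful for j >= 2. *)
Definition pvec (j : nat) : ptype := [fsfun i in [fset j - 2]%fset => 1].

(* The vertices of an N-gon are 0, ..., N-1 in cyclic order, and the roof is the
   side {0, N-1}.  A side or diagonal is a pair (a, b) with a < b.  The vertices
   being labelled, subdivisions are not identified up to symmetry, which is what
   distinguishing the roof means.  The 2-gon has one (empty) subdivision. *)
Section Polygon.
Variable N : nat.

Definition is_side (p : 'I_N * 'I_N) : bool :=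
  (p.1.+1 == p.2 :> nat) || (p.1 == 0 :> nat) && (p.2.+1 == N).

Definition is_diagonal (p : 'I_N * 'I_N) : bool :=
  (p.1 < p.2) && ~~ is_side p.

Definition crossing (p q : 'I_N * 'I_N) : bool :=
  [&& p.1 < q.1, q.1 < p.2 & p.2 < q.2]
  || [&& q.1 < p.1, p.1 < q.2 & q.2 < p.2].

Definition is_subdivision (D : {set 'I_N * 'I_N}) : bool :=
  [forall p in D, is_diagonal p]
  && [forall p in D, forall q in D, ~~ crossing p q].

(* For a < b in V: one of the two open arcs between a and b avoids V. *)
Definition consecutive (V : {set 'I_N}) (a b : 'I_N) : bool :=
  [forall c in V, ~~ ((a < c) && (c < b))]
  || [forall c in V, ~~ ((c < a) || (b < c))].

(* V is the vertex set of a piece cut out by D: its boundary edges are sides of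
   the polygon or diagonals in D, and no diagonal in D joins two nonconsecutive
   vertices of V. *)
Definition is_piece (D : {set 'I_N * 'I_N}) (V : {set 'I_N}) : bool :=
  (2 < #|V|) &&
  [forall a in V, forall b in V,
     (a < b) ==>
       ((((a, b) \in D) || is_side (a, b)) == consecutive V a b)].

Definition num_pieces (D : {set 'I_N * 'I_N}) (s : nat) : nat :=
  #|[pred V : {set 'I_N} | is_piece D V && (#|V| == s)]|.

End Polygon.

(* A polygon cut into m_2 triangles, m_3 quadrilaterals, ... by diagonals has
   2 + m_2 + 2 m_3 + 3 m_4 + ... sides. *)
Definition num_sides (m : ptype) : nat :=
  2 + \sum_(i <- finsupp m) i.+1 * m i.

Definition hyper_catalan (m : ptype) : nat :=
  #|[pred D : {set 'I_(num_sides m) * 'I_(num_sides m)} |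
      is_subdivision D && `[< forall i : nat, num_pieces D i.+3 = m i >] ]|.

Definition kfamily := {fsfun ptype -> nat with 0}.

(* The constraint sum_n k_n n = m - \vec{j} is written without subtraction, so
   that it has no solution when m - \vec{j} has a negative entry. *)
Definition admissible (m : ptype) (j : nat) (k : kfamily) : Prop :=
  \sum_(n <- finsupp k) k n = j /\
  forall i : nat, \sum_(n <- finsupp k) k n * n i + pvec j i = m i.

Definition multinomial (j : nat) (k : kfamily) : nat :=
  j`! %/ \prod_(n <- finsupp k) (k n)`!.

(* Main.v *)
(** Order the vertices of an N-gon along a line from one end of the roof to the
    other.  Sides and diagonals are then intervals, the sides other than the roof
    being the unit ones, and noncrossing means that these intervals form a
    laminar family.  A subdivision is thus a plane tree with N - 1 leaves and no
    unary vertex; its pieces are the internal vertices, a vertex with j children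
    being a (j+1)-gon.  The recurrence counts trees by the number j of children
    of the root and by the multiset k of the types of the root subtrees: the
    types can be ordered in (j choose k) ways, and each ordering is realised by
    the product of the C_n. *)
From HB Require Import structures.
Require Import Defs.
From mathcomp Require Import all_boot finmap zify.
From mathcomp Require Import boolp classical_sets fsbigop.

Set Implicit Arguments.
Unset Strict Implicit.
Unset Printing Implicit Defensive.

(** * Plane forests and their edges *)

(* [FCons c s]: the first tree has children [c], and [s] holds its right
   siblings.  A plane tree is thus encoded by the forest of its children, and
   [FNil] is the tree reduced to a leaf. *)
Inductive forest := FNil | FCons of forest & forest.

HB.instance Definition _ := gen_eqMixin forest.

Fixpoint num_trees (f : forest) : nat :=
  if f is FCons _ s then (num_trees s).+1 else 0.

(** The maximum with 1 makes a tree without children count as one leaf, although its forest of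
    children is empty. *)
Fixpoint leaves (f : forest) : nat :=
  if f is FCons c s then maxn 1 (leaves c) + leaves s else 0.

Definition width (c : forest) : nat := maxn 1 (leaves c).

Fixpoint no_unary (f : forest) : bool :=
  if f is FCons c s then [&& num_trees c != 1, no_unary c & no_unary s] else true.

(** [no_unary c] leaves the number of trees of [c] free; as the children of a root, [c] must in
    addition not consist of a single tree. *)
Definition no_unary_tree (c : forest) : bool :=
  (num_trees c != 1) && no_unary c.

(* The leaves of [f] are laid out on the unit intervals starting at [a], and
   each vertex of [f] is the interval [x, y] spanned by its leaves. *)
Fixpoint fedge (f : forest) (a x y : nat) : bool :=
  if f is FCons c s then
    [|| (x == a) && (y == a + width c), fedge c a x y
      | fedge s (a + width c) x y]
  else false.

Fixpoint fcat (f g : forest) : forest :=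
  if f is FCons c s then FCons c (fcat s g) else g.

Lemma width_gt0 c : 0 < width c.
Proof. by rewrite /width; lia. Qed.

Lemma leaves_width c s : leaves (FCons c s) = width c + leaves s.
Proof. by []. Qed.

Lemma width_leaves c : c <> FNil -> width c = leaves c.
Proof. by case: c => // c s _; have := width_gt0 c; rewrite /width /=; lia. Qed.

Lemma leaves_le_width c : leaves c <= width c.
Proof. by rewrite /width; lia. Qed.

Lemma leaves_eq0 f : leaves f = 0 -> f = FNil.
Proof. by case: f => // c s; rewrite leaves_width; have := width_gt0 c; lia. Qed.

Lemma fedge_bounds f a x y :
  fedge f a x y -> [&& a <= x, x < y & y <= a + leaves f].
Proof.
elim: f a => //= c IHc s IHs a; have := width_gt0 c; have := leaves_le_width c.
rewrite -[maxn 1 _]/(width c).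
move=> h1 h2 /or3P [/andP[/eqP -> /eqP ->]|/IHc|/IHs]; lia.
Qed.

Lemma fedge_unit f a i : a <= i < a + leaves f -> fedge f a i i.+1.
Proof.
elim: f a => [|c IHc s IHs] a; first by rewrite /=; lia.
rewrite leaves_width /= => h.
case: (ltnP i (a + width c)) => hi; last first.
  by rewrite IHs ?orbT //; lia.
case: (c =P FNil) => [c0|cn].
  by rewrite c0 /width /= in hi *; apply/orP; left; apply/andP; split; lia.
by rewrite IHc ?orbT // -width_leaves //; lia.
Qed.

Lemma fedge_noncrossing f a x y x' y' :
  fedge f a x y -> fedge f a x' y' -> ~~ [&& x < x', x' < y & y < y'].
Proof.
elim: f a => //= c IHc s IHs a; have := leaves_le_width c => hw.
move=> /or3P [/andP[/eqP -> /eqP ->]|h1|h1] /or3P [/andP[/eqP -> /eqP ->]|h2|h2];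
  try (exact: IHc h1 h2); try (exact: IHs h1 h2);
  try have := fedge_bounds h1; try have := fedge_bounds h2; lia.
Qed.

Lemma num_trees_cat f g : num_trees (fcat f g) = num_trees f + num_trees g.
Proof. by elim: f => //= c _ s ->. Qed.

Lemma leaves_cat f g : leaves (fcat f g) = leaves f + leaves g.
Proof. by elim: f => //= c _ s ->; rewrite addnA. Qed.

Lemma no_unary_cat f g : no_unary (fcat f g) = no_unary f && no_unary g.
Proof. by elim: f => //= c _ s ->; rewrite !andbA. Qed.

Lemma fedge_cat f g a x y :
  fedge (fcat f g) a x y = fedge f a x y || fedge g (a + leaves f) x y.
Proof.
elim: f a => [|c _ s IHs] a /=; first by rewrite addn0.
by rewrite IHs -!orbA -addnA.
Qed.

(** The longest edge starting at [a] is thus that of the first tree, so that the edges alone reveal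
    its width. *)
Lemma fedge_first_bound c s a y :
  fedge (FCons c s) a a y -> y <= a + width c.
Proof.
have hw := leaves_le_width c; have h0 := width_gt0 c.
by move=> /= /or3P [/andP[_ /eqP ->]|/fedge_bounds|/fedge_bounds]; lia.
Qed.

(** A vertex that is not unary never shares its interval with a descendant: the first of at least
    two children stops short of the right end. *)
Lemma fedge_top c a : num_trees c != 1 -> fedge c a a (a + width c) = false.
Proof.
case: c => // c [//|d s] _; apply/negP => /fedge_first_bound.
rewrite width_leaves // !leaves_width; have := width_gt0 d; lia.
Qed.

(** The longest edge at [a] gives the width of the first tree. The other edges ending within this
    width are those below its root, and the edges starting beyond it are those of the siblings, so
    both parts are recovered by induction. *)
Lemma fedge_inj f g a :
  no_unary f -> no_unary g -> fedge f a =2 fedge g a -> f = g.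
Proof.
have first_edge c s b : fedge (FCons c s) b b (b + width c).
  by rewrite /= !eqxx.
elim: f g a => [|c IHc s IHs] [|c' s'] a //.
- by move=> _ _ /(_ a (a + width c')); rewrite first_edge.
- by move=> _ _ /(_ a (a + width c)); rewrite first_edge.
move=> /and3P [c1 wc ws] /and3P [c1' wc' ws'] E.
have Ew : width c = width c'.
  have := first_edge c s a; rewrite E => /fedge_first_bound.
  by have := first_edge c' s' a; rewrite -E => /fedge_first_bound; lia.
have childE d r (d1 : num_trees d != 1) x y : fedge d a x y =
    [&& fedge (FCons d r) a x y, y <= a + width d & ~~ ((x == a) && (y == a + width d))].
  apply/idP/and3P => [h|[/= /or3P [->//|//|/fedge_bounds]]]; last by lia.
  split; first by rewrite /= h orbT.
    by have := fedge_bounds h; have := leaves_le_width d; lia.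
  by apply: contraL h => /andP [/eqP -> /eqP ->]; rewrite fedge_top.
have sibE d r x y : fedge r (a + width d) x y =
    fedge (FCons d r) a x y && (a + width d <= x).
  have hw := leaves_le_width d; have h0 := width_gt0 d.
  apply/idP/andP => [h|[/= /or3P [/andP [/eqP -> _]|/fedge_bounds|//]]]; try lia.
  by split; [rewrite /= h !orbT | have := fedge_bounds h; lia].
congr FCons.
  by apply: (IHc _ a) => // x y; rewrite (childE c s) // (childE c' s') // E Ew.
by apply: (IHs _ (a + width c)) => // x y; rewrite sibE {2}Ew sibE E Ew.
Qed.

(** * Reconstruction of a forest from a laminar family of intervals *)

Section ForestOfRelation.
Variable E : rel nat.
Hypothesis E_lt : forall x y, E x y -> x < y.
Hypothesis E_noncrossing : forall x y x' y',
  E x y -> E x' y' -> ~~ [&& x < x', x' < y & y < y'].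

(* Cut [a, b] at the largest [u < b] such that [E a u]: noncrossing makes every
   other edge inside [a, b], except possibly (a, b), lie in [a, u] or [u, b]. *)
Lemma forest_of_rel a b :
  a <= b -> (forall i, a <= i < b -> E i i.+1) ->
  exists f, [/\ no_unary f, leaves f = b - a &
    forall x y, a <= x -> y <= b -> E x y = fedge f a x y].
Proof.
move: {2}(b - a) (leqnn (b - a)) => n; elim: n a b => [|n IHn] a b hn hab Eu.
  exists FNil; split => // [|x y ax yb]; first by rewrite /=; lia.
  by apply/negP => /E_lt; lia.
case: (ltngtP a.+1 b) => hb; last 1 first.
- exists (FCons FNil FNil); split => // [|x y ax yb]; first by rewrite /=; lia.
  rewrite /= /width /= orbF; apply/idP/andP => [/E_lt ?|[/eqP -> /eqP ->]].
    by split; lia.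
  by rewrite maxn0 addn1; apply: Eu; lia.
- have exu : exists u, (u < b) && E a u.
    by exists a.+1; rewrite hb Eu //; lia.
  have ubu u : (u < b) && E a u -> u <= b by lia.
  case: (ex_maxnP exu ubu) => u /andP [ub Eau] umax.
  have au := E_lt Eau.
  have [|||f [wf lf Ef]] := IHn a u; try lia; first by move=> i hi; apply: Eu; lia.
  have [|||g [wg lg Eg]] := IHn u b; try lia; first by move=> i hi; apply: Eu; lia.
  have fg x y : a <= x -> y <= b -> ~~ ((x == a) && (y == b)) ->
      E x y = fedge (fcat f g) a x y.
    move=> ax yb nab; rewrite fedge_cat lf subnKC ?(ltnW au) //.
    case: (leqP y u) => yu.
      rewrite (Ef _ _ ax yu); case: (boolP (fedge g u x y)); last by rewrite orbF.
      by move=> /fedge_bounds; lia.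
    case: (leqP u x) => ux.
      rewrite (Eg _ _ ux yb); case: (boolP (fedge f a x y)) => //.
      by move=> /fedge_bounds; lia.
    (* Here x < u < y. Such an edge would cross (a, u) if a < x, and would contradict the maximality
       of u if x = a, since then y < b. *)
    have -> : E x y = false.
      apply/negP => Exy.
      case: (x =P a) => xa; last first.
        by have := E_noncrossing Eau Exy; lia.
      rewrite {}xa in Exy nab *.
      by have := umax y; rewrite Exy andbT; lia.
    by symmetry; apply/negP => /orP [] /fedge_bounds; lia.
  have lfg : leaves (fcat f g) = b - a by rewrite leaves_cat lf lg; lia.
  have wfg : no_unary (fcat f g) by rewrite no_unary_cat wf.
  have nfg : fcat f g <> FNil by move=> h; rewrite h /= in lfg; lia.
  case: (boolP (E a b)) => Eab; last first.
    exists (fcat f g); split=> // x y ax yb.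
    case: (boolP ((x == a) && (y == b))) => [/andP [/eqP -> /eqP ->]|/fg ->//].
    rewrite (negbTE Eab); symmetry; apply/negP; rewrite fedge_cat lf.
    by move=> /orP [] /fedge_bounds; lia.
  (* As (a, b) is an edge, both parts are placed under a new vertex, which is not unary because [f]
     and [g] are both nonempty. *)
  exists (FCons (fcat f g) FNil); split.
  + rewrite /= wfg !andbT num_trees_cat.
    case: (f) lf => [|? ?]; first by rewrite /=; lia.
    case: (g) lg => [|? ?]; first by rewrite /=; lia.
    by rewrite /=; lia.
  + by rewrite leaves_width width_leaves // lfg addn0.
  + move=> x y ax yb /=; rewrite orbF width_leaves // lfg subnKC //.
    by case: (boolP ((x == a) && (y == b))) => [/andP [/eqP -> /eqP ->]|/fg ->].
- have -> : a = b by lia.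
  exists FNil; split => // [|x y ax yb]; first by rewrite subnn.
  by apply/negP => /E_lt; lia.
Qed.

(** The edge (a, b) lies within the first tree of the forest by [fedge_first_bound], so that tree
    takes up the whole width and has no sibling. *)
Lemma tree_of_rel a b :
  a < b -> (forall i, a <= i < b -> E i i.+1) -> E a b ->
  exists c, [/\ no_unary_tree c, width c = b - a &
    forall x y, a <= x -> y <= b -> E x y = fedge (FCons c FNil) a x y].
Proof.
move=> ab Eu Eab; have [f [wf lf Ef]] := forest_of_rel (ltnW ab) Eu.
have := Eab; rewrite Ef //; case: f wf lf Ef => [//|c s] /= /and3P [c1 wc ws] lf Ef.
rewrite -[maxn 1 _]/(width c) in lf; rewrite -/(fedge (FCons c s) a a b).
move=> /fedge_first_bound hb.
have s0 : s = FNil by apply: leaves_eq0; lia.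
rewrite s0 /= addn0 in lf Ef; exists c; split=> //.
by rewrite /no_unary_tree c1 wc.
Qed.

End ForestOfRelation.

(** * Pieces of a plane forest *)

Definition adjacent (V : seq nat) (x y : nat) : bool :=
  all (fun v => ~~ ((x < v) && (v < y))) V
  || all (fun v => ~~ ((v < x) || (y < v))) V.

(** Analogue of [is_piece] for sequences, where [E] holds for sides and diagonals alike. Sortedness
    makes a piece determined by its set of entries. *)
Definition piece_of (E : rel nat) (V : seq nat) : bool :=
  [&& sorted ltn V, 2 < size V &
    all (fun x => all (fun y => (x < y) ==> (E x y == adjacent V x y)) V) V].

Lemma piece_ofP E V :
  reflect [/\ sorted ltn V, 2 < size V &
    forall x y, x \in V -> y \in V -> x < y -> E x y = adjacent V x y]
    (piece_of E V).
Proof.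
apply: (iffP and3P) => [[sV gV h]|[sV gV h]]; split=> //.
- by move=> x y xV yV xy; move: h => /allP /(_ x xV) /allP /(_ y yV); rewrite xy => /eqP.
- by apply/allP => x xV; apply/allP => y yV; apply/implyP => xy; rewrite h.
Qed.

Lemma piece_of_eq (E E' : rel nat) V :
  (forall x y, x \in V -> y \in V -> x < y -> E x y = E' x y) ->
  piece_of E V = piece_of E' V.
Proof.
by move=> h; apply/piece_ofP/piece_ofP => -[? ? h']; split=> // x y xV yV xy;
  rewrite -h' // h.
Qed.

Lemma sorted_extrema V : sorted ltn V -> 2 < size V ->
  exists x y z, [/\ x \in V, y \in V, z \in V, (x < z) && (z < y) &
    forall v, v \in V -> (x <= v) && (v <= y)].
Proof.
move=> sV gV; exists (nth 0 V 0), (nth 0 V (size V).-1), (nth 0 V 1).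
have mono i j : i < j < size V -> nth 0 V i < nth 0 V j.
  by move=> h; apply: (sorted_ltn_nth ltn_trans 0 sV); rewrite ?inE; lia.
have memV i : i < size V -> nth 0 V i \in V by apply: mem_nth.
split; try (by apply: memV; lia).
  by rewrite !mono //; lia.
move=> _ /(nthP 0) [i hi0 <-]; have hi : i < size V := hi0; apply/andP; split.
  by case: i {hi0} hi => // i hi; rewrite ltnW // mono //; lia.
case: (i =P (size V).-1) => [->//|ni].
by rewrite ltnW // mono //; lia.
Qed.

Lemma extrema_adjacent V x y :
  (forall v, v \in V -> (x <= v) && (v <= y)) -> adjacent V x y.
Proof. by move=> h; apply/orP; right; apply/allP => v /h; lia. Qed.

Lemma neighbours V x y z : x \in V -> y \in V -> (x < z) && (z < y) -> z \notin V ->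
  exists p q, [/\ p \in V, q \in V, (p < z) && (z < q) &
    all (fun v => ~~ ((p < v) && (v < q))) V].
Proof.
move=> xV yV /andP [xz zy] zV.
have exp : exists p, (p \in V) && (p < z) by exists x; rewrite xV.
have ubp p : (p \in V) && (p < z) -> p <= z by lia.
have exq : exists q, (q \in V) && (z < q) by exists y; rewrite yV.
case: (ex_maxnP exp ubp) => p /andP [pV pz] pmax.
case: (ex_minnP exq) => q /andP [qV zq] qmin.
exists p, q; split; rewrite ?pz //; apply/allP => v vV.
have vz : v != z by apply: contraNneq zV => <-.
by have := pmax v; have := qmin v; rewrite vV /=; lia.
Qed.

(** The end points of the intervals of the successive trees: when [f] is the forest of children of a
    vertex, these are the corners of its piece. *)
Fixpoint verts (f : forest) (a : nat) : seq nat :=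
  a :: (if f is FCons c s then verts s (a + width c) else [::]).

Lemma size_verts f a : size (verts f a) = (num_trees f).+1.
Proof. by elim: f a => //= c _ s IHs a; rewrite IHs. Qed.

Lemma mem_verts_first f a : a \in verts f a.
Proof. by case: f => [|? ?] /=; rewrite inE eqxx. Qed.

Lemma mem_verts_last f a : a + leaves f \in verts f a.
Proof.
elim: f a => [|c _ s IHs] a; first by rewrite addn0 mem_verts_first.
by rewrite leaves_width addnA /= inE IHs orbT.
Qed.

Lemma verts_bounds f a u : u \in verts f a -> (a <= u) && (u <= a + leaves f).
Proof.
elim: f a => [|c _ s IHs] a /=; rewrite inE; first by move=> /eqP ->; lia.
rewrite -[maxn 1 _]/(width c).
by move=> /orP [/eqP ->|/IHs]; lia.
Qed.

Lemma sorted_verts f a : sorted ltn (verts f a).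
Proof.
elim: f a => [|c _ s IHs] a //=.
rewrite path_sortedE; last exact: ltn_trans.
rewrite IHs andbT; apply/allP => u /verts_bounds; have := width_gt0 c; lia.
Qed.

Lemma verts_not_inside f a u x y :
  u \in verts f a -> fedge f a x y -> ~~ ((x < u) && (u < y)).
Proof.
elim: f a => [|c _ s IHs] a //=; have hw := leaves_le_width c; rewrite inE.
move=> /orP [/eqP ->|hu] /or3P [/andP [/eqP -> /eqP ->]|h|h]; try exact: IHs hu h;
  try have := verts_bounds hu; try have := fedge_bounds h; lia.
Qed.

Lemma verts_fedge f a x y : x \in verts f a -> y \in verts f a -> x < y ->
  all (fun v => ~~ ((x < v) && (v < y))) (verts f a) -> fedge f a x y.
Proof.
elim: f a => [|c _ s IHs] a; first by rewrite /= !inE => /eqP -> /eqP ->; lia.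
have h0 := width_gt0 c.
rewrite /= !inE => /orP [/eqP ->|xs] /orP [/eqP ->|ys] xy /andP [_ hall]; first by lia.
- move/allP: hall => /(_ _ (mem_verts_first _ _)).
  have := verts_bounds ys => ? ?; apply/or3P; apply: Or31.
  by rewrite eqxx /=; lia.
- by have := verts_bounds xs; lia.
- by rewrite IHs ?orbT.
Qed.

(** Nothing in [V] lies outside its extreme entries, so these are adjacent and joined by an edge.
    This edge, the one facing the roof, locates the piece in the forest. *)
Lemma piece_extrema (f : forest) a V : piece_of (fedge f a) V ->
  exists x y z, [/\ x \in V, y \in V, z \in V, (x < z) && (z < y) &
    (forall v, v \in V -> (x <= v) && (v <= y)) /\ fedge f a x y].
Proof.
move=> /piece_ofP [sV gV h].
have [x [y [z [xV yV zV xzy hV]]]] := sorted_extrema sV gV.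
exists x, y, z; split=> //; split=> //; rewrite h //; last by lia.
exact: extrema_adjacent.
Qed.

Lemma piece_bounds f a V v :
  piece_of (fedge f a) V -> v \in V -> (a <= v) && (v <= a + leaves f).
Proof.
move=> /piece_extrema [x [y [z [xV yV zV xzy [hV /fedge_bounds h]]]]] /hV; lia.
Qed.

Section PieceCons.
Variables (c s : forest) (a : nat).
Hypothesis c1 : num_trees c != 1.

Lemma piece_verts : c <> FNil -> piece_of (fedge (FCons c s) a) (verts c a).
Proof.
move=> cn; have wl := width_leaves cn; apply/piece_ofP; split.
- exact: sorted_verts.
- by rewrite size_verts; case: c cn c1 => // ? [].
move=> x y xV yV xy; have bx := verts_bounds xV; have by_ := verts_bounds yV.
apply/idP/idP => [/= /or3P [/andP [/eqP -> /eqP ->]|h|/fedge_bounds]|/orP []].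
- by apply: extrema_adjacent => v /verts_bounds; lia.
- by apply/orP; left; apply/allP => v /verts_not_inside /(_ h).
- by lia.
- by move=> /(verts_fedge xV yV xy) h; rewrite /= h orbT.
- move=> /allP h; have := h _ (mem_verts_first _ _); have := h _ (mem_verts_last _ _).
  by move=> h1 h2; apply/or3P; apply: Or31; apply/andP; split; lia.
Qed.

(** If a corner u were missing from [V], its neighbours in [V] would be joined by an edge passing
    over u; z rules out the root interval, and no edge of [c] passes over a corner. If [V] had a
    further entry u, the child interval around u would be an edge between entries of [V], so it
    would have to be the whole root interval, against [fedge_top]. *)
Lemma piece_top V x y z : piece_of (fedge (FCons c s) a) V ->
  [/\ x \in V, y \in V, z \in V, (x < z) && (z < y) &
    forall v, v \in V -> (x <= v) && (v <= y)] ->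
  x = a -> y = a + width c -> c <> FNil /\ V = verts c a.
Proof.
move=> /piece_ofP [sV gV hE] [xV yV zV xzy hV] xa ya.
have cn : c <> FNil by move=> c0; move: ya; rewrite c0 /width /=; lia.
split=> //; have wl := width_leaves cn.
have subV u : u \in verts c a -> u \in V.
  move=> uc; apply/negPn/negP => uV.
  have ub := verts_bounds uc.
  have ux : u != x by apply: contraNneq uV => ->.
  have uy : u != y by apply: contraNneq uV => ->.
  have [|p [q [pV qV puq pq]]] := neighbours xV yV _ uV; first by lia.
  have : fedge (FCons c s) a p q.
    by rewrite hE //; [apply/orP; left | lia].
  move=> /= /or3P [/andP [/eqP pa /eqP qa]|h|/fedge_bounds].
  - by move/allP: pq => /(_ z zV); lia.
  - by have := verts_not_inside uc h; lia.
  - by have := hV q qV; lia.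
apply: (irr_sorted_eq ltn_trans ltnn sV (sorted_verts _ _)) => u.
apply/idP/idP => [uV|/subV//]; apply/negPn/negP => uc.
have xc : x \in verts c a by rewrite xa mem_verts_first.
have yc : y \in verts c a by rewrite ya wl mem_verts_last.
have ux : u != x by apply: contraNneq uc => ->.
have uy : u != y by apply: contraNneq uc => ->.
have [|p [q [pc qc puq pq]]] := neighbours xc yc _ uc.
  by have := hV u uV; lia.
have h : fedge c a p q by apply: verts_fedge => //; lia.
have : adjacent V p q.
  rewrite -hE ?subV //; last by lia.
  by rewrite /= h orbT.
move=> /orP [/allP /(_ u uV)|/allP hpq]; first by lia.
have := hpq _ xV; have := hpq _ yV; have := hV _ (subV _ pc); have := hV _ (subV _ qc).
move=> h1 h2 h3 h4.
have pa : p = a by lia.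
have qa : q = a + width c by lia.
by rewrite pa qa fedge_top in h.
Qed.

Lemma piece_child V x y :
  [/\ x \in V, y \in V & forall v, v \in V -> (x <= v) && (v <= y)] ->
  fedge c a x y ->
  piece_of (fedge (FCons c s) a) V = piece_of (fedge c a) V.
Proof.
move=> [xV yV hV] h; apply: piece_of_eq => p q pV qV pq /=.
have hb := fedge_bounds h; have hw := leaves_le_width c.
have hp := hV p pV; have hq := hV q qV.
have -> : fedge s (a + width c) p q = false by apply/negP => /fedge_bounds; lia.
rewrite orbF; case: (boolP (_ && _)) => //= /andP [/eqP pa /eqP qa].
have xa : x = a by lia.
have ya : y = a + width c by lia.
by rewrite xa ya fedge_top in h.
Qed.

Lemma piece_sibling V x y :
  [/\ x \in V, y \in V & forall v, v \in V -> (x <= v) && (v <= y)] ->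
  fedge s (a + width c) x y ->
  piece_of (fedge (FCons c s) a) V = piece_of (fedge s (a + width c)) V.
Proof.
move=> [xV yV hV] h; apply: piece_of_eq => p q pV qV pq /=.
have hb := fedge_bounds h; have hw := leaves_le_width c; have h0 := width_gt0 c.
have hp := hV p pV; have hq := hV q qV.
have -> : fedge c a p q = false by apply/negP => /fedge_bounds; lia.
by have -> : (p == a) = false by lia.
Qed.

(** The three cases are the possible places of the extreme edge: the first root, below it, or among
    its right siblings. In the last two, no other edge joins entries of [V]. *)
Lemma piece_cons V : piece_of (fedge (FCons c s) a) V =
  [|| (c != FNil) && (V == verts c a), piece_of (fedge c a) V
    | piece_of (fedge s (a + width c)) V].
Proof.
apply/idP/or3P => [hP|].
  have [x [y [z [xV yV zV xzy [hV]]]]] := piece_extrema hP.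
  move=> /= /or3P [/andP [/eqP xa /eqP ya]|h|h].
  - have [/eqP cn ->] := piece_top hP (And5 xV yV zV xzy hV) xa ya.
    by apply: Or31; rewrite cn eqxx.
  - by apply: Or32; rewrite -(piece_child _ h).
  - by apply: Or33; rewrite -(piece_sibling _ h).
move=> [/andP [/eqP cn /eqP ->]|hP|hP]; first exact: piece_verts.
- have [x [y [z [xV yV zV xzy [hV h]]]]] := piece_extrema hP.
  by rewrite (piece_child _ h).
- have [x [y [z [xV yV zV xzy [hV h]]]]] := piece_extrema hP.
  by rewrite (piece_sibling _ h).
Qed.

End PieceCons.

Fixpoint pieces (f : forest) (a : nat) : seq (seq nat) :=
  if f is FCons c s then
    (if c is FNil then [::] else [:: verts c a])
      ++ pieces c a ++ pieces s (a + width c)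
  else [::].

Lemma mem_pieces f a V : no_unary f -> (V \in pieces f a) = piece_of (fedge f a) V.
Proof.
elim: f a => [|c IHc s IHs] a /=.
  by move=> _; apply/esym/negP => hP;
    have [x [y [z [_ _ _ _ []]]]] := @piece_extrema FNil a V hP.
move=> /and3P [c1 wc ws]; rewrite -[X in piece_of X]/(fedge (FCons c s) a).
rewrite piece_cons // !mem_cat IHc // IHs //; congr orb.
have [->|/eqP cn] := eqVneq c FNil; first by [].
by case: c cn {IHc c1 wc} => // ? ? _; rewrite mem_seq1.
Qed.

(** A piece among the siblings reaches beyond [a + width c], which no piece of the first tree does.
    The root piece is not a piece of [c], because its extreme pair is not an edge of [c] by
    [fedge_top]. *)
Lemma uniq_pieces f a : no_unary f -> uniq (pieces f a).
Proof.
elim: f a => [|c IHc s IHs] a //= /and3P [c1 wc ws].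
have disj V : V \in pieces s (a + width c) ->
    (forall v, v \in V -> v <= a + width c) -> False.
  rewrite mem_pieces // => hP hV.
  have [x [y [z [xV yV zV xzy [_ /fedge_bounds]]]]] := piece_extrema hP.
  by have := hV _ yV; lia.
have disjcs : ~~ has (mem (pieces c a)) (pieces s (a + width c)).
  apply/hasPn => V Vs; apply/negP => Vc; apply: (disj V Vs) => v.
  move: Vc; rewrite inE mem_pieces // => /piece_bounds h /h.
  by have := leaves_le_width c; lia.
have U : uniq (pieces c a ++ pieces s (a + width c)).
  by rewrite cat_uniq IHc // IHs // disjcs.
rewrite cat_uniq U andbT.
case: (c =P FNil) => [->|cn]; first by rewrite /=; apply/hasPn.
have -> : (if c is FNil then [::] else [:: verts c a]) = [:: verts c a] by case: (c) cn.
rewrite /=; apply/hasPn => V; rewrite mem_cat => /orP VP.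
rewrite inE; apply/negP => /eqP VE; rewrite {}VE in VP; have wl := width_leaves cn.
case: VP => [|Vs]; last by apply: (disj _ Vs) => v /verts_bounds; lia.
rewrite mem_pieces // => /piece_ofP [_ _ h].
have := h a (a + leaves c) (mem_verts_first _ _) (mem_verts_last _ _).
rewrite -wl fedge_top // extrema_adjacent; first by have := width_gt0 c; lia.
by move=> v /verts_bounds; lia.
Qed.

(** Listed in the same order as [pieces], so that the two lists correspond entry by entry. *)
Fixpoint arities (f : forest) : seq nat :=
  if f is FCons c s then
    (if c is FNil then [::] else [:: num_trees c]) ++ arities c ++ arities s
  else [::].

Lemma size_pieces f a : map size (pieces f a) = map succn (arities f).
Proof.
elim: f a => [|c IHc s IHs] a //=; rewrite !map_cat IHc IHs; congr cat.
by case: (c) => // d r; rewrite map_cons size_verts.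
Qed.

Lemma arities_gt1 f d : no_unary f -> d \in arities f -> 1 < d.
Proof.
elim: f => [|c IHc s IHs] //= /and3P [c1 wc ws]; rewrite !mem_cat.
move=> /or3P [|/(IHc wc)//|/(IHs ws)//].
by case: (c) c1 => // ? ?; rewrite mem_seq1 => + /eqP ->; rewrite /=; lia.
Qed.

(** Growing the forest from [num_trees f] leaves, each internal vertex turns one leaf into d leaves,
    a gain of d - 1. *)
Lemma leaves_arities f :
  no_unary f -> leaves f = num_trees f + \sum_(d <- arities f) d.-1.
Proof.
elim: f => [|c IHc s IHs]; first by rewrite big_nil.
rewrite leaves_width /= => /and3P [c1 wc ws]; rewrite !big_cat /= (IHs ws).
case: (c =P FNil) => [->|cn]; first by rewrite !big_nil /width /=; lia.
rewrite width_leaves // (IHc wc).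
by case: (c) cn => // d r _; rewrite big_seq1 /=; lia.
Qed.

(** * Subdivisions of a polygon as plane trees *)

Definition ord_seq (N : nat) (V : {set 'I_N}) : seq nat := map val (enum V).

Lemma sorted_ord_seq N (V : {set 'I_N}) : sorted ltn (ord_seq V).
Proof.
apply: (subseq_sorted ltn_trans _ (iota_ltn_sorted 0 N)).
by rewrite -val_enum_ord /ord_seq map_subseq // enumT filter_subseq.
Qed.

Lemma mem_ord_seq N (V : {set 'I_N}) (i : 'I_N) : (val i \in ord_seq V) = (i \in V).
Proof. by rewrite mem_map ?mem_enum //; apply: val_inj. Qed.

Lemma ord_seq_inj N : injective (@ord_seq N).
Proof. by move=> V W h; apply/setP => i; rewrite -!mem_ord_seq h. Qed.

Lemma size_ord_seq N (V : {set 'I_N}) : size (ord_seq V) = #|V|.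
Proof. by rewrite size_map cardE. Qed.

Lemma adjacent_ord_seq N (V : {set 'I_N}) (x y : 'I_N) :
  adjacent (ord_seq V) x y = consecutive V x y.
Proof.
have allE (P : pred nat) : all P (ord_seq V) = [forall c in V, P (val c)].
  rewrite all_map; apply/allP/forall_inP => h i.
    by move=> iV; apply: h; rewrite mem_enum.
  by rewrite mem_enum => /h.
by rewrite /adjacent !allE.
Qed.

(** [FCons c FNil] is the whole tree, root included; [is_diagonal] discards the edges that are sides
    of the polygon. *)
Definition tree_diagonals (N : nat) (c : forest) : {set 'I_N * 'I_N} :=
  [set p | is_diagonal p && fedge (FCons c FNil) 0 p.1 p.2].

Section TreeDiagonals.
Variables (N : nat) (c : forest).
Hypothesis N_width : N = (width c).+1.

(** The sides left out of [tree_diagonals] are all edges of the tree: the roof is the root, and each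
    other side is a unit interval carrying a leaf. *)
Lemma edge_tree_diagonals (p : 'I_N * 'I_N) : p.1 < p.2 ->
  (p \in tree_diagonals N c) || is_side p = fedge (FCons c FNil) 0 p.1 p.2.
Proof.
move=> lp; rewrite inE /is_diagonal lp /=;
case: (boolP (is_side p)) => [|_] /=; last by rewrite orbF.
move=> /orP [/eqP h|/andP [/eqP -> /eqP h]].
  have := @fedge_unit (FCons c FNil) 0 p.1; rewrite h leaves_width /= => -> //.
  by have := ltn_ord p.2; lia.
have -> : nat_of_ord p.2 = width c by lia.
by rewrite !eqxx.
Qed.

Lemma subdivision_tree_diagonals : is_subdivision (tree_diagonals N c).
Proof.
apply/andP; split; first by apply/forall_inP => p; rewrite inE => /andP [].
apply/forall_inP => p; rewrite inE => /andP [_ hp].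
apply/forall_inP => q; rewrite inE => /andP [_ hq].
by rewrite /crossing negb_or (fedge_noncrossing hp hq) (fedge_noncrossing hq hp).
Qed.

Lemma is_piece_tree_diagonals (V : {set 'I_N}) :
  is_piece (tree_diagonals N c) V = piece_of (fedge (FCons c FNil) 0) (ord_seq V).
Proof.
rewrite /is_piece -size_ord_seq; apply/andP/piece_ofP => [[gV h]|[sV gV h]]; split=> //.
- exact: sorted_ord_seq.
- move=> _ _ /mapP [x xV ->] /mapP [y yV ->] xy.
  rewrite !mem_enum in xV yV.
  move: h => /forall_inP /(_ x xV) /forall_inP /(_ y yV) /implyP /(_ xy) /eqP.
  by rewrite edge_tree_diagonals // adjacent_ord_seq.
- apply/forall_inP => x xV; apply/forall_inP => y yV; apply/implyP => xy.
  by rewrite edge_tree_diagonals // -adjacent_ord_seq h ?mem_ord_seq.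
Qed.

Hypothesis c_no_unary : no_unary_tree c.

Lemma num_pieces_tree_diagonals i :
  num_pieces (tree_diagonals N c) i.+1 = count_mem i (arities (FCons c FNil)).
Proof.
have wf : no_unary (FCons c FNil) by rewrite /= andbT.
have -> : count_mem i (arities (FCons c FNil)) =
    count [pred W | size W == i.+1] (pieces (FCons c FNil) 0).
  rewrite -(count_map size (pred1 i.+1)) size_pieces count_map.
  exact: eq_count.
rewrite /num_pieces cardE -(size_map (@ord_seq N)) -size_filter.
apply/perm_size/uniq_perm.
- by rewrite map_inj_uniq ?enum_uniq //; apply: ord_seq_inj.
- exact/filter_uniq/uniq_pieces.
move=> W; rewrite mem_filter mem_pieces //; apply/mapP/andP.
  move=> [V]; rewrite mem_enum unfold_in /= is_piece_tree_diagonals -size_ord_seq.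
  by move=> /andP [? ?] ->.
move=> [sW pW];  pose V : {set 'I_N} := [set j | val j \in W].
have WV : W = ord_seq V.
  have [sortW _ _] := piece_ofP _ _ pW.
  apply: (irr_sorted_eq ltn_trans ltnn sortW (sorted_ord_seq _)) => u.
  apply/idP/mapP => [uW|[j]]; last by rewrite mem_enum inE => ? ->.
  have uN : u < N by have := piece_bounds pW uW; rewrite leaves_width /=; lia.
  by exists (Ordinal uN); rewrite ?mem_enum ?inE.
exists V => //; rewrite mem_enum unfold_in /=.
by rewrite is_piece_tree_diagonals -size_ord_seq -WV pW.
Qed.

End TreeDiagonals.

(** Adding the sides back to the diagonals recovers all edges of the tree, and [fedge_inj]
    applies. *)
Lemma tree_diagonals_inj N c c' :
  N = (width c).+1 -> N = (width c').+1 -> no_unary_tree c -> no_unary_tree c' ->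
  tree_diagonals N c = tree_diagonals N c' -> c = c'.
Proof.
move=> hN hN' wc wc' h.
suff: FCons c FNil = FCons c' FNil by case.
apply: (@fedge_inj _ _ 0); rewrite /= ?andbT //.
have aux d d' : N = (width d).+1 -> N = (width d').+1 ->
    tree_diagonals N d = tree_diagonals N d' ->
    forall x y, fedge (FCons d FNil) 0 x y -> fedge (FCons d' FNil) 0 x y.
  move=> hd hd' hdd x y hxy; have := fedge_bounds hxy; rewrite leaves_width /= => hb.
  have xN : x < N by lia.
  have yN : y < N by lia.
  have xy : x < y by lia.
  have := @edge_tree_diagonals N d' hd' (Ordinal xN, Ordinal yN) xy.
  by rewrite -hdd (@edge_tree_diagonals N d hd) //= => <-.
by move=> x y; apply/idP/idP; apply: aux.
Qed.

Lemma subdivision_tree N (D : {set 'I_N * 'I_N}) : 1 < N -> is_subdivision D ->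
  exists c, [/\ no_unary_tree c, N = (width c).+1 & D = tree_diagonals N c].
Proof.
move=> N1 /andP [/forall_inP Dd /forall_inP Dn].
(* All sides, the roof included, are adjoined to the diagonals. Sides cross nothing, so the relation
   stays laminar and [tree_of_rel] applies on [0, N - 1]. *)
pose E : rel nat := fun x y =>
  [&& x < y, y < N & [|| y == x.+1, (x == 0) && (y.+1 == N)
    | [exists p in D, (p.1 == x :> nat) && (p.2 == y :> nat)]]].
have Elt x y : E x y -> x < y by move=> /and3P [].
have Enc x y x' y' : E x y -> E x' y' -> ~~ [&& x < x', x' < y & y < y'].
  move=> /and3P [xy yN /or3P [h|h|/exists_inP [p pD /andP [/eqP h1 /eqP h2]]]]
    /and3P [xy' yN' /or3P [h'|h'|/exists_inP [q qD /andP [/eqP h1' /eqP h2']]]]; try lia.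
  move/forall_inP: (Dn p pD) => /(_ q qD).
  by rewrite /crossing negb_or h1 h2 h1' h2' => /andP [].
have Eu i : 0 <= i < N.-1 -> E i i.+1.
  by move=> hi; rewrite /E eqxx; apply/and3P; split=> //; lia.
have Etop : E 0 N.-1.
  by apply/and3P; split; try lia; apply/or3P; apply: Or32; apply/andP; split; lia.
have [|c [wc hw Ec]] := tree_of_rel Elt Enc _ Eu Etop; first by lia.
exists c; split=> //; first by lia.
apply/setP => -[x y]; rewrite inE.
have yN : y <= N.-1 by have := ltn_ord y; lia.
rewrite -[fedge _ _ _ _](Ec x y (leq0n _) yN).
apply/idP/andP => [h|[hd]].
  split; first exact: Dd.
  have /andP [xy _] := Dd _ h; apply/and3P; split=> //.
  by apply/or3P; apply: Or33; apply/exists_inP; exists (x, y); rewrite //= !eqxx.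
move/andP: hd => [_]; rewrite /is_side /= negb_or => /andP [h1 h2].
move=> /and3P [_ _ /or3P [h|h|/exists_inP [[p q] pD /= /andP [/eqP hp /eqP hq]]]].
- by rewrite (eqP h) eqxx in h1.
- by rewrite h in h2.
- by rewrite -(val_inj hp) -(val_inj hq).
Qed.

(** A vertex with d children is a (d+1)-gon, hence counted by m_d, which a [ptype] stores at
    position d - 2. *)
Definition tree_type (c : forest) : ptype :=
  [fsfun i in seq_fset tt [seq d - 2 | d <- arities (FCons c FNil)] =>
     count_mem i.+2 (arities (FCons c FNil))].

Lemma tree_typeE c i : tree_type c i = count_mem i.+2 (arities (FCons c FNil)).
Proof.
rewrite /tree_type fsfun_fun seq_fsetE; case: ifP => // /negP h.
apply/esym/count_memPn; apply/negP => hi; apply: h.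
by apply/mapP; exists i.+2 => //; rewrite subn2.
Qed.

Lemma num_sides_tree_type c : no_unary_tree c -> num_sides (tree_type c) = (width c).+1.
Proof.
move=> wc; have wf : no_unary (FCons c FNil) by rewrite /= andbT.
have := leaves_arities wf; rewrite leaves_width /= addn0 => ->.
rewrite -/(arities (FCons c FNil)) /num_sides add2n add1n; congr _.+2.
set A := arities _.
(* The arities are grouped by value; for d = i + 2, the summand d - 1 is the factor i + 1 of
   [num_sides]. *)
transitivity (\sum_(i <- finsupp (tree_type c)) \sum_(d <- A | d == i.+2) d.-1).
  apply: eq_bigr => i _; rewrite tree_typeE -sum1_count big_distrr /=.
  by apply: eq_bigr => d /eqP ->; rewrite muln1.
rewrite (exchange_big_dep xpredT) //=; apply: eq_big_seq => d dA.
have d1 := arities_gt1 wf dA.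
(* As d is at least 2, it contributes at the single index d - 2, which is in the support because d
   occurs in [A]. *)
rewrite (eq_bigl (pred1 (d - 2))); last by move=> i /=; lia.
rewrite -big_filter filter_pred1_uniq ?fset_uniq ?big_seq1 //.
rewrite mem_finsupp tree_typeE subn2.
case: d d1 dA => [|[|d]] //= _ dA.
by rewrite -lt0n -has_count has_pred1.
Qed.

(** The list is the image of the counted subdivisions under a choice [g] of a tree for each. [g] is
    injective because [tree_diagonals] recovers the subdivision, and [tree_diagonals_inj] shows that
    every tree of type [m] is reached. *)
Lemma trees_of_type m : exists T : seq forest,
  [/\ uniq T, size T = hyper_catalan m &
    forall c, (c \in T) = no_unary_tree c && (tree_type c == m)].
Proof.
set A := [pred D : {set 'I_(num_sides m) * 'I_(num_sides m)} |
  is_subdivision D && `[< forall i : nat, num_pieces D i.+3 = m i >]].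
have /choice [g gP] : forall D, exists c, A D ->
    [/\ no_unary_tree c, num_sides m = (width c).+1 & D = tree_diagonals _ c].
  move=> D; case: (boolP (is_subdivision D)) => hD.
    by have [//|c hc] := subdivision_tree _ hD; exists c.
  (* [FNil] is a dummy value: [A D] is false here. *)
  by exists FNil; rewrite /= (negbTE hD).
exists [seq g D | D <- enum A]; split.
- rewrite map_inj_in_uniq ?enum_uniq // => D D'; rewrite !mem_enum => hD hD' gD.
  by have [_ _ ->] := gP D hD; have [_ _ ->] := gP D' hD'; rewrite gD.
- by rewrite size_map -cardE.
move=> c; apply/mapP/andP => [[D]|[wc /eqP hm]].
  rewrite mem_enum => hD ->; have [wg hN Dg] := gP D hD; split=> //.
  have /andP [_ /asboolP hp] := hD.
  apply/eqP/fsfunP => i; rewrite tree_typeE -hp {2}Dg.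
  by rewrite num_pieces_tree_diagonals.
have hN : num_sides m = (width c).+1 by rewrite -hm num_sides_tree_type.
have hA : A (tree_diagonals (num_sides m) c).
  apply/andP; split; first exact: subdivision_tree_diagonals.
  by apply/asboolP => i; rewrite num_pieces_tree_diagonals // -tree_typeE hm.
exists (tree_diagonals (num_sides m) c); first by rewrite mem_enum.
have [wg hNg Dg] := gP _ hA; exact: tree_diagonals_inj Dg.
Qed.

Definition trees (m : ptype) : seq forest := sval (cid (trees_of_type m)).

Lemma trees_uniq m : uniq (trees m).
Proof. by rewrite /trees; case: cid => T []. Qed.

Lemma size_trees m : size (trees m) = hyper_catalan m.
Proof. by rewrite /trees; case: cid => T []. Qed.

Lemma mem_trees m c : (c \in trees m) = no_unary_tree c && (tree_type c == m).
Proof. by rewrite /trees; case: cid => T []. Qed.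

(** * Counting forests by the types of their trees *)

Fixpoint types (f : forest) : seq ptype :=
  if f is FCons c s then tree_type c :: types s else [::].

Lemma size_types f : size (types f) = num_trees f.
Proof. by elim: f => //= c _ s ->. Qed.

Lemma count_arities f i : count_mem i.+2 (arities f) = \sum_(n <- types f) n i.
Proof.
elim: f => [|c _ s IHs] /=; first by rewrite big_nil.
by rewrite big_cons tree_typeE /= cats0 catA count_cat IHs.
Qed.

(** The internal vertices other than the root are distributed among the root subtrees, and the root
    itself contributes the [pvec] term. It has at least two children, so the truncated [j - 2] in
    [pvec] is exact. *)
Lemma tree_type_types c i : c <> FNil -> no_unary_tree c ->
  tree_type c i = \sum_(n <- types c) n i + pvec (num_trees c) i.
Proof.
move=> cn /andP [c1 _]; rewrite tree_typeE -count_arities /pvec fsfun_fun inE /= cats0.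
rewrite count_cat addnC; congr (_ + _).
by case: c cn c1 => //= d [//|e s] _ _; rewrite addn0; case: eqP; case: eqP => //=; lia.
Qed.

Fixpoint forests (l : seq ptype) : seq forest :=
  if l is n :: l' then [seq FCons c s | c <- trees n, s <- forests l'] else [:: FNil].

Lemma mem_forests l f : (f \in forests l) = no_unary f && (types f == l).
Proof.
elim: l f => [|n l IHl] [|c s] /=.
- by rewrite mem_seq1 !eqxx.
- by rewrite mem_seq1 andbF; apply/negbTE/eqP.
- by apply/allpairsP => -[[? ?] []].
- apply/allpairsP/andP => [[[c' s'] /= [+ + [-> ->]]]|].
    rewrite mem_trees IHl => /andP [/andP [-> ->] /eqP ->] /andP [-> /eqP ->].
    by rewrite eqxx.
  move=> [/and3P [c1 wc ws] /eqP [hc hs]]; exists (c, s); split=> //=.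
    by rewrite mem_trees /no_unary_tree c1 wc hc eqxx.
  by rewrite IHl ws hs eqxx.
Qed.

Lemma forests_uniq l : uniq (forests l).
Proof.
elim: l => //= n l IHl; apply: allpairs_uniq => //; first exact: trees_uniq.
by move=> [? ?] [? ?] _ _ /= [-> ->].
Qed.

Lemma size_forests l : size (forests l) = \prod_(n <- l) hyper_catalan n.
Proof.
elim: l => [|n l IHl] /=; first by rewrite big_nil.
by rewrite size_allpairs IHl big_cons size_trees.
Qed.

(** * Multisets of types and their orderings *)

Definition profile (l : seq ptype) : kfamily :=
  [fsfun n in seq_fset tt l => count_mem n l].

Lemma profileE l n : profile l n = count_mem n l.
Proof.
rewrite /profile fsfun_fun seq_fsetE; case: ifP => // /negbT h.
exact/esym/count_memPn.
Qed.

(** One list realising the multiset [k]; its permutations are the possible sequences of types of the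
    root subtrees. *)
Definition expand (k : kfamily) : seq ptype :=
  flatten [seq nseq (k n) n | n <- finsupp k].

Lemma count_expand k n : count_mem n (expand k) = k n.
Proof.
rewrite /expand count_flatten sumnE !big_map.
under eq_bigr do rewrite count_nseq /=.
case: finsuppP => [nk|nk].
  by rewrite big_seq big1 // => i ik; case: eqP => // ein; rewrite -ein ik in nk.
rewrite (bigD1_seq n) ?fset_uniq //= eqxx mul1n big1 ?addn0 // => i /negbTE ->.
by [].
Qed.

Lemma profile_eq l k : (profile l == k) = perm_eq l (expand k).
Proof.
apply/eqP/idP => [<-|h].
  by apply/allP => n _ /=; rewrite count_expand profileE.
by apply/fsfunP => n; rewrite profileE -(count_expand k); apply/permP.
Qed.

Lemma sum_expand (F : ptype -> nat) k :
  \sum_(n <- expand k) F n = \sum_(n <- finsupp k) k n * F n.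
Proof.
rewrite /expand big_flatten big_map; apply: eq_bigr => n _.
by rewrite big_nseq iter_addn_0 mulnC.
Qed.

Lemma prod_expand (F : ptype -> nat) k :
  \prod_(n <- expand k) F n = \prod_(n <- finsupp k) F n ^ k n.
Proof.
rewrite /expand big_flatten big_map; apply: eq_bigr => n _.
by rewrite big_nseq iter_muln_1.
Qed.

Lemma size_expand k : size (expand k) = \sum_(n <- finsupp k) k n.
Proof. by rewrite -sum1_size sum_expand; apply: eq_bigr => n _; rewrite muln1. Qed.

Lemma sum_count_fibers (U : Type) (I : eqType) (g : U -> I) (r : seq I) (T : seq U) :
  uniq r -> \sum_(i <- r) count (fun c => g c == i) T = count (fun c => g c \in r) T.
Proof.
move=> ur; elim: T => [|c T IHT] /=; first by rewrite big1.
rewrite big_split /= IHT; congr (_ + _); rewrite -count_uniq_mem // -sumn_count.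
by rewrite sumnE big_map; apply: eq_bigr => i _; rewrite eq_sym.
Qed.

(** Arrangements are sorted by their first letter x, leaving an arrangement of [rem x s]. Only the
    factorial at x changes, by the factor [count_mem x s], and these multiplicities add up to
    [size s]. [U] is later the support of a family. *)
Lemma size_permutations_mul (T : eqType) (s U : seq T) : uniq U -> {subset s <= U} ->
  size (permutations s) * \prod_(x <- U) (count_mem x s)`! = (size s)`!.
Proof.
move=> uU; move: {2}(size s) (erefl (size s)) => n.
elim: n s => [|n IHn] s sn sU.
  have -> : s = [::] by apply: size0nil.
  by rewrite big1 //; rewrite muln1.
rewrite (perm_size (permutationsE _)) ?sn //.
rewrite size_allpairs_dep sumnE big_map big_distrl /=.
transitivity (\sum_(x <- undup s) count_mem x s * n`!).
  rewrite big_seq [RHS]big_seq; apply: eq_bigr => x; rewrite mem_undup => xs.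
  have rx : size (rem x s) = n by rewrite size_rem // sn.
  rewrite -rx -IHn //; last by move=> y /mem_rem /sU.
  rewrite mulnCA; congr (_ * _).
  rewrite (bigD1_seq x) ?sU //= [in RHS](bigD1_seq x) ?sU //= mulnA.
  have cx : count_mem x s = (count_mem x (rem x s)).+1.
    by rewrite (permP (perm_to_rem xs)) /= eqxx.
  rewrite cx factS; congr (_ * _); apply: eq_bigr => y yx.
  by rewrite (permP (perm_to_rem xs) (pred1 y)) /= eq_sym (negbTE yx).
rewrite -big_distrl /= factS; congr (_ * _).
rewrite (sum_count_fibers id) ?undup_uniq // -sn -[RHS]count_predT.
by apply: eq_in_count => x xs; rewrite mem_undup.
Qed.

Definition forests_of_profile (k : kfamily) : seq forest :=
  flatten [seq forests l | l <- permutations (expand k)].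

Lemma mem_forests_of_profile k f :
  (f \in forests_of_profile k) = no_unary f && (profile (types f) == k).
Proof.
rewrite profile_eq; apply/flatten_mapP/andP => [[l]|[wf h]].
  by rewrite mem_permutations mem_forests => h /andP [-> /eqP ->].
by exists (types f); rewrite ?mem_permutations // mem_forests wf eqxx.
Qed.

Lemma forests_of_profile_uniq k : uniq (forests_of_profile k).
Proof.
rewrite /forests_of_profile; have := permutations_uniq (expand k).
elim: (permutations _) => //= l ls IH /andP [hl /IH h].
rewrite cat_uniq forests_uniq h andbT /=; apply/hasPn => f /flatten_mapP [l' l'ls].
rewrite mem_forests => /andP [_ /eqP fl']; apply: contra hl.
by rewrite mem_forests fl' => /andP [_ /eqP <-].
Qed.

(** Every ordering of the types admits the same number of forests, the product of the
    [hyper_catalan n], and the multinomial coefficient counts the orderings. *)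
Lemma size_forests_of_profile k j : \sum_(n <- finsupp k) k n = j ->
  size (forests_of_profile k) =
    multinomial j k * \prod_(n <- finsupp k) hyper_catalan n ^ k n.
Proof.
move=> <-; rewrite /forests_of_profile size_flatten /shape -map_comp sumnE big_map.
rewrite -prod_expand big_seq (eq_bigr (fun=> \prod_(n <- expand k) hyper_catalan n)).
  rewrite -big_seq big_const_seq count_predT iter_addn_0 mulnC; congr (_ * _).
  have sub : {subset expand k <= finsupp k}.
    by move=> n /flatten_mapP [n' n'k]; rewrite mem_nseq => /andP [_ /eqP ->].
  have := size_permutations_mul (fset_uniq _) sub.
  rewrite size_expand /multinomial => <-.
  under [X in _ * X]eq_bigr do rewrite count_expand.
  by rewrite mulnK // prodn_gt0 // => n; apply: fact_gt0.
by move=> l; rewrite mem_permutations => h /=; rewrite size_forests; apply: perm_big.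
Qed.

Lemma admissible_profile l k m j : perm_eq l (expand k) ->
  admissible m j k <-> size l = j /\ forall i, \sum_(n <- l) n i + pvec j i = m i.
Proof.
move=> h; rewrite (perm_size h) size_expand /admissible.
by split=> -[<- hi]; split=> // i; rewrite -hi (perm_big _ h) sum_expand.
Qed.

(** By [tree_type_types], the constraints on the family of root subtrees say exactly that the tree
    has type [m] and j children at the root. *)
Lemma admissible_tree c m j : c <> FNil -> no_unary_tree c ->
  admissible m j (profile (types c)) <-> num_trees c = j /\ tree_type c = m.
Proof.
move=> cn wc; have h : perm_eq (types c) (expand (profile (types c))).
  by rewrite -profile_eq.
rewrite (admissible_profile _ _ h) size_types; split=> -[<- hm]; split=> //.
  by apply/fsfunP => i; rewrite tree_type_types.
by move=> i; rewrite -tree_type_types // hm.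
Qed.

(** [A] may be infinite, but only the values that [g] takes on [T] give nonzero terms; [r] lists
    those lying in [A]. *)
Lemma fsbig_count_fibers (U : eqType) (I : choiceType) (g : U -> I) (A : set I)
    (T : seq U) :
  \big[addn/0]_(i \in A) count (fun c => g c == i) T = count (fun c => g c \in A) T.
Proof.
pose r := undup [seq i <- map g T | i \in A].
rewrite (fsbigE r) ?undup_uniq //=.
- rewrite big_seq_cond (eq_bigl (fun i => i \in r)); last first.
    move=> i; rewrite andbC; case: (boolP (i \in r)); rewrite ?andbF // andbT.
    by rewrite mem_undup mem_filter => /andP [].
  rewrite -big_seq sum_count_fibers ?undup_uniq //.
  by apply: eq_in_count => c cT; rewrite mem_undup mem_filter map_f // andbT.
- by move=> i /=; rewrite mem_undup mem_filter => /andP [/set_mem].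
move=> i Ai; rewrite mem_undup mem_filter mem_set //= => h.
apply/eqP; rewrite -leqn0 leqNgt -has_count; apply: contra h.
by move=> /hasP [c cT /eqP <-]; apply: map_f.
Qed.

(* \big[addn/0]_(x \in A) F x sums F over the elements of A where F is nonzero;
   both index sets below have finitely many such elements. *)
Theorem theorem2 :
  hyper_catalan ptype0 = 1 /\
  forall m : ptype, m <> ptype0 ->
    hyper_catalan m =
      \big[addn/0]_(j \in [set j : nat | 2 <= j]%classic)
        \big[addn/0]_(k \in [set k : kfamily | admissible m j k]%classic)
          (multinomial j k * \prod_(n <- finsupp k) hyper_catalan n ^ k n).
Proof.
have type0 : tree_type FNil = ptype0.
  by apply/fsfunP => i; rewrite tree_typeE /ptype0 fsfun0E.
split.
  rewrite -size_trees -[RHS]/(size [:: FNil]).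
  apply/perm_size/uniq_perm => // [|c]; first exact: trees_uniq.
  rewrite mem_trees mem_seq1; apply/andP/eqP => [[wc /eqP h]|->]; last by rewrite type0.
  case: (c =P FNil) => // cn.
  (* The root of a tree other than the leaf is itself counted in the type, which is therefore
     nonzero. *)
  have : num_trees c - 2 \in finsupp (tree_type c).
    rewrite mem_finsupp tree_type_types //= /pvec fsfun_fun inE eqxx.
    by rewrite addn1.
  by rewrite h /ptype0 in_finsupp0.
move=> m m0.
have treeP c : c \in trees m -> [/\ c <> FNil, no_unary_tree c & tree_type c = m].
  by rewrite mem_trees => /andP [wc /eqP hm]; split=> // c0; apply: m0; rewrite -hm c0.
(* The outer sum sorts the trees of type [m] by the number of children of the root; it is at least
   2, since [m] nonzero excludes the leaf. *)
rewrite (@eq_fsbigr _ _ _ _ _ (fun j => count (fun c => num_trees c == j) (trees m))).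
  rewrite fsbig_count_fibers -size_trees -count_predT; apply: eq_in_count => c.
  move=> /treeP [cn /andP [c1 _] _]; rewrite mem_set //=.
  by case: c cn c1 => // ? [].
move=> j; rewrite inE /= => j2.
(* For fixed j, the inner sum sorts these trees by the multiset of types of their root subtrees. *)
rewrite (@eq_fsbigr _ _ _ _ _
  (fun k => count (fun c => profile (types c) == k) (trees m))).
  rewrite fsbig_count_fibers; apply: eq_in_count => c /treeP [cn wc hm].
  apply/idP/eqP; rewrite inE /=; first by move=> /(admissible_tree _ _ cn wc) [].
  by move=> hj; apply/(admissible_tree _ _ cn wc).
move=> k; rewrite inE /= => hk; rewrite -size_forests_of_profile; last by case: hk.
rewrite -size_filter; apply/perm_size/uniq_perm.
- exact: forests_of_profile_uniq.
- exact/filter_uniq/trees_uniq.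
move=> c; rewrite mem_filter mem_forests_of_profile mem_trees andbC.
case: (profile (types c) =P k) => //= hc; rewrite -hc in hk.
have nc : num_trees c = j.
  have h : perm_eq (types c) (expand (profile (types c))) by rewrite -profile_eq.
  by have [] := (admissible_profile _ _ h).1 hk; rewrite size_types.
have cn : c <> FNil by move=> c0; rewrite c0 /= in nc; lia.
apply/idP/andP => [wc|[/andP []//]].
(* A forest of profile [k] has j trees, and j is at least 2, so putting them under a root creates no
   unary vertex. *)
have wt : no_unary_tree c by rewrite /no_unary_tree wc nc andbT; lia.
by have [_ ->] := (admissible_tree _ _ cn wt).1 hk.
Qed.
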